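(* Let $\varphi$ be a Musielak–Orlicz function of uniformly lower type $p_\varphi^-$ for some $p_\varphi^-\in[1,\infty)$. If the Doob maximal operator $M$ is bounded on $L^{\varphi^*}(\Omega)$, then there is $C>0$ such that for every sequence $(g_k)_{k\in\mathbb N}$ of nonnegative $\mathcal F$-measurable functions (not necessarily adapted), $$\Big\|\sum_{k\in\mathbb N}\mathbb E_k(g_k)\Big\|_{L^\varphi(\Omega)}\le C\Big\|\sum_{k\in\mathbb N}g_k\Big\|_{L^\varphi(\Omega)}.$$
   Context: Let $(\Omega,\mathcal F,\mathbb P)$ be a probability space, $(\mathcal F_n)_{n\in\mathbb Z_+}$ a nondecreasing sequence of sub-$\sigma$-algebras of $\mathcal F$, $\mathbb E_n$ the conditional expectation w.r.t. $\mathcal F_n$, and $M(f):=\sup_{n\in\mathbb Z_+}|\mathbb E_n f|$. A Musielak–Orlicz function is $\varphi:\Omega\times[0,\infty)\to[0,\infty)$ with $\varphi(x,\cdot)$ nondecreasing, $\varphi(x,0)=0$, $\lim_{t\to\infty}\varphi(x,t)=\infty$ for each $x$, and $\varphi(\cdot,t)$ measurable for each $t$. For a function $\psi$ of this kind, $\|f\|_{L^\psi(\Omega)}:=\inf\{\lambda>0:\int_\Omega\psi(x,|f(x)|/\lambda)\,d\mathbb P\le1\}$. Uniformly lower type $p$: there is $C$ with $\varphi(x,st)\le Cs^p\varphi(x,t)$ for all $x$, $t\ge0$, $s\in(0,1)$. The complementary function is $\varphi^*(x,t):=\sup_{u>0}[ut-\varphi(x,u)]$. *)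

(* Defs.v *)
From HB Require Import structures.
From mathcomp Require Import all_boot all_order all_algebra.
From mathcomp Require Import all_classical all_reals all_analysis.
From mathcomp Require Import measurable_realfun.
Set Implicit Arguments. Unset Strict Implicit. Unset Printing Implicit Defensive.
Import Order.TTheory GRing.Theory Num.Theory.
Import numFieldNormedType.Exports.
Local Open Scope classical_set_scope.
Local Open Scope ring_scope.

(* Musielak--Orlicz function phi : Omega x [0,oo) -> [0,oo) (we only
   constrain its values for t >= 0). *)
Definition MO_function (R : realType) (d : measure_display) (T : measurableType d)
  (phi : T -> R -> R) : Prop :=
  [/\ (forall x t, 0 <= t -> 0 <= phi x t),
      (forall x s t, 0 <= s -> s <= t -> phi x s <= phi x t),
      (forall x, phi x 0 = 0),
      (forall x, phi x t @[t --> +oo] --> +oo) &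
      (forall t, measurable_fun setT (fun x => phi x t))].

Definition unif_lower_type (R : realType) (T : Type) (phi : T -> R -> R) (p : R)
  : Prop :=
  exists C : R, forall x t s, 0 <= t -> 0 < s < 1 ->
    phi x (s * t) <= C * powR s p * phi x t.

Definition compl_fun (R : realType) (T : Type) (phi : T -> R -> R) : T -> R -> \bar R :=
  fun x t => ereal_sup [set ((u * t - phi x u)%:E) | u in [set u : R | 0 < u]].

Definition ext_at (R : realType) (T : Type) (psi : T -> R -> \bar R) (x : T)
  (v : \bar R) : \bar R :=
  match v with
  | r%:E => psi x r
  | _ => +oo%E
  end.

(* Luxemburg (quasi-)norm ||f||_{L^psi}, an extended real (+oo if no lambda works) *)
Definition lux_norm (R : realType) (d : measure_display) (T : measurableType d)
  (P : probability T R) (psi : T -> R -> \bar R) (f : T -> \bar R) : \bar R :=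
  ereal_inf [set (lam%:E) | lam in
    [set lam : R | 0 < lam /\
      (\int[P]_x ext_at psi x (`| f x | / lam%:E)%E <= 1)%E]].

Definition is_condexp (R : realType) (d : measure_display) (T : measurableType d)
  (P : probability T R) (G : set (set T)) (f h : T -> \bar R) : Prop :=
  [/\ (forall x, (0 <= h x)%E),
      (forall B : set (\bar R), measurable B -> G (h @^-1` B)) &
      (forall A, G A -> (\int[P]_(x in A) h x = \int[P]_(x in A) f x)%E)].

Definition filtration (d : measure_display) (T : measurableType d)
  (F : nat -> set (set T)) : Prop :=
  [/\ (forall n, sigma_algebra setT (F n)),
      (forall n, F n `<=` measurable) &
      (forall n m, (n <= m)%N -> F n `<=` F m)].

Definition doob_max (R : realType) (T : Type)
  (E : nat -> (T -> \bar R) -> T -> \bar R) (f : T -> \bar R) : T -> \bar R :=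
  fun x => ereal_sup (range (fun n => `| E n f x |%E)).

(* Main.v *)
Require Import Defs.
From HB Require Import structures.
From mathcomp Require Import all_boot all_order all_algebra.
From mathcomp Require Import all_classical all_reals all_analysis.
From mathcomp Require Import measurable_realfun ring lra.
Import Order.TTheory GRing.Theory Num.Theory.
Import numFieldNormedType.Exports.
Import HBNNSimple.
Local Open Scope classical_set_scope.
Local Open Scope ring_scope.

(** A duality argument. Put G = sum_k g_k and S = sum_k E_k(g_k). For h >= 0,
    symmetry of conditional expectations gives
    int S h = sum_k int g_k E_k(h) <= int G M(h), which Young's inequality and the
    boundedness of M on L^(phi^* ) bound by the norm of G times that of h. Lower
    type at least 1 makes phi(w) / (C w) an approximate subgradient of phi at w,
    so h = phi(v) / (C v), for bounded approximations v of a multiple of S from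
    below, nearly attains equality in Young's inequality; this bounds int phi(v),
    and monotone convergence finishes. *)

(** * Integration tools for functions of doubtful measurability *)

(* The integral of a nonnegative function is a supremum over the simple
   functions below it, so monotonicity requires no measurability. This matters
   because phi(x, f x) need not be measurable when phi(x, .) is discontinuous. *)
Lemma le_integralT (d : measure_display) (T : measurableType d) (R : realType)
  (mu : {measure set T -> \bar R}) (f g : T -> \bar R) :
  (forall x, 0 <= f x)%E -> (forall x, f x <= g x)%E ->
  (\int[mu]_x f x <= \int[mu]_x g x)%E.
Proof.
move=> f0 fg; have g0 x : (0 <= g x)%E := le_trans (f0 x) (fg x).
rewrite !ge0_integralTE//; apply: le_ereal_sup => _ [h hf <-].
by exists h => // x; exact: le_trans (hf x) (fg x).
Qed.

(** In the application [b] is the complementary function at a maximal function, a supremum over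
    uncountably many [u]. The truncated difference [c] is measurable, lies below [b] and satisfies
    [f <= a + c], so additivity is applied to [a + c]. *)
Lemma le_integralT_add (d : measure_display) (T : measurableType d)
  (R : realType) (mu : {measure set T -> \bar R}) (f a b : T -> \bar R) :
  measurable_fun setT f -> measurable_fun setT a ->
  (forall x, 0 <= f x)%E -> (forall x, 0 <= a x)%E -> (forall x, 0 <= b x)%E ->
  (forall x, f x <= a x + b x)%E ->
  (\int[mu]_x f x <= \int[mu]_x a x + \int[mu]_x b x)%E.
Proof.
move=> mf ma f0 a0 b0 fab.
pose c x := maxe (f x - a x)%E 0%E.
have mc : measurable_fun setT c.
  by apply: measurable_maxe => //; apply: emeasurable_funB.
have c0 x : (0 <= c x)%E by rewrite le_max lexx orbT.
have cb x : (c x <= b x)%E.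
  rewrite /c ge_max b0 andbT; move: (fab x) (f0 x) (a0 x) (b0 x).
  case: (f x) => [r| |]; case: (a x) => [s| |]; case: (b x) => [t| |] //=;
    rewrite ?leey ?leNye // -?EFinB -?EFinD ?lee_fin//; lra.
have fac x : (f x <= a x + c x)%E.
  move: (c0 x) (f0 x) (a0 x); rewrite /c.
  case: (a x) => [s| |]//; last first.
    by move=> c0x _ _; rewrite addye ?leey// gt_eqF// (lt_le_trans _ c0x).
  case: (f x) => [r| |]//.
  by move=> _ _ _; rewrite -EFinB -EFin_max -EFinD lee_fin -lerBlDl le_max lexx.
apply: (@le_trans _ _ (\int[mu]_x (a x + c x)%E)%E); first exact: le_integralT.
by rewrite ge0_integralD// leeD2l// le_integralT.
Qed.

(** As [v] takes finitely many values, the preimage splits into finitely many pieces on which the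
    second argument of [psi] is frozen. *)
Lemma measurable_fun_comp_nnsfun (d : measure_display) (T : measurableType d)
  (R : realType) (psi : T -> R -> R) (v : {nnsfun T >-> R}) :
  (forall t, measurable_fun setT (psi ^~ t)) ->
  measurable_fun setT (fun x => psi x (v x)).
Proof.
move=> mpsi _ B mB; rewrite setTI.
have -> : (fun x => psi x (v x)) @^-1` B =
    \bigcup_(y in range v) (v @^-1` [set y] `&` psi ^~ y @^-1` B).
  apply/seteqP; split => [x Bx|x [y _ [/= -> //]]].
  by exists (v x); [exact: imageT|split].
apply: fin_bigcup_measurable => [|y _]; first exact: fimfunP.
by apply: measurableI => //; rewrite -[X in measurable X]setTI; exact: mpsi.
Qed.

(** * Conditional expectations integrated against [G]-measurable functions *)

Section condexp.
Context (R : realType) (d : measure_display) (T : measurableType d).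
Variables (P : probability T R) (G : set (set T)).
Hypotheses (sG : sigma_algebra setT G) (GT : G `<=` measurable).

(** Simple functions increasing to [u] have level sets in [G], and on such sets [h] and [f] have
    equal integrals; monotone convergence concludes. *)
Lemma integralM_condexp (f h u : T -> \bar R) :
  measurable_fun setT f -> (forall x, 0 <= f x)%E -> is_condexp P G f h ->
  (forall x, 0 <= u x)%E ->
  (forall B : set (\bar R), measurable B -> G (u @^-1` B)) ->
  (\int[P]_x (h x * u x)%E = \int[P]_x (f x * u x)%E)%E.
Proof.
move=> mf f0 [h0 Gh hf] u0 Gu.
have mh : measurable_fun setT h by move=> _ B mB; rewrite setTI; apply/GT/Gh.
(* [TG] is [T] with [G] as its sigma-algebra, so that the approximants of [u] are [G]-measurable. *)
pose TG : measurableType _ := g_sigma_algebraType G.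
have mG (A : set T) : (measurable : set (set TG)) A -> G A.
  by rewrite measurable_g_measurableTypeE.
have mu : measurable_fun setT (u : TG -> \bar R).
  move=> _ B mB; rewrite setTI; rewrite measurable_g_measurableTypeE//.
  exact: Gu.
pose v : {nnsfun TG >-> R}^nat := nnsfun_approx measurableT mu.
have Gv n y : G (v n @^-1` [set y]) by apply: mG; exact: measurable_sfunP.
have finv n : finite_set (range (v n)) by exact: fimfunP.
have vu x : (v n x)%:E @[n --> \oo] --> u x.
  exact: (@cvg_nnsfun_approx _ TG R _ measurableT u mu).
have vnd x : {homo (fun n => v n x) : m n / (m <= n)%N >-> m <= n}.
  move=> m n mn.
  exact: (lefP _ _ (@nd_nnsfun_approx _ TG R _ measurableT u mu m n mn)).
have vu_le n x : ((v n x)%:E <= u x)%E.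
  have vxnd : nondecreasing_seq (fun n => (v n x)%:E).
    by move=> m k mk; rewrite lee_fin vnd.
  rewrite -(cvg_lim _ (vu x))// (cvg_lim _ (ereal_nondecreasing_cvgn vxnd))//.
  by apply: ereal_sup_ubound; exists n.
have vx0 n x : u x = 0%E -> v n x = 0.
  move=> ux0; apply/eqP; rewrite eq_le fun_ge0 andbT -lee_fin.
  by rewrite (le_trans (vu_le n x))// ux0.
have mv n : measurable_fun setT (v n : T -> R).
  by move=> _ B mB; rewrite setTI; apply/GT/mG/measurable_sfunP.
have intE (k : T -> \bar R) : measurable_fun setT k -> (forall x, 0 <= k x)%E ->
    (\int[P]_x (k x * u x)%E)%E =
    limn (fun n => \sum_(y \in range (v n))
      (y%:E * \int[P]_(x in v n @^-1` [set y]) k x)%E).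
  move=> mk k0.
  have -> : (\int[P]_x (k x * u x)%E =
      \int[P]_x limn (fun n => k x * (v n x)%:E)%E)%E.
    apply: eq_integral => x _; apply/esym/cvg_lim => //.
    (* With [k x] infinite, the product passes to the limit only if [u x] is nonzero; where
       [u x = 0] every approximant vanishes and the product is constantly zero. *)
    have [ux0|ux0] := eqVneq (u x) 0%E.
      rewrite ux0 mule0; under eq_fun do rewrite vx0// mule0.
      exact: cvg_cst.
    have [kfin|kinf] := boolP (k x \is a fin_num); first exact: cvgeZl.
    by apply: cvgeM => //; [exact: mule_def_infty_neq0|exact: cvg_cst].
  rewrite monotone_convergence//; last 3 first.
  - move=> n; apply: emeasurable_funM => //; apply/measurable_EFinP.
    exact: mv.
  - by move=> n x _; rewrite mule_ge0// lee_fin.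
  - by move=> x _ m n mn; apply: lee_wpmul2l => //; rewrite lee_fin vnd.
  congr (limn _); apply/funext => n.
  transitivity (\int[P]_x \sum_(y \in range (v n))
      (y%:E * (k x * (\1_(v n @^-1` [set y]) x)%:E))%E)%E.
    apply: eq_integral => x _; rewrite [in LHS]fimfunE -fsumEFin//.
    rewrite ge0_mule_fsumr => [|y]; last by rewrite EFinM nnfun_muleindic_ge0.
    by apply: eq_fsbigr => y _; rewrite EFinM muleCA.
  have mA y : measurable (v n @^-1` [set y] : set T) by exact: GT.
  have mk1 y : measurable_fun setT
      (fun x => k x * (\1_(v n @^-1` [set y]) x)%:E)%E.
    by apply: emeasurable_funM => //; apply/measurable_EFinP/measurable_indic.
  rewrite ge0_integral_fsum//; last 2 first.
  - by move=> y; exact: emeasurable_funM.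
  - by move=> y x _; rewrite muleCA mule_ge0// nnfun_muleindic_ge0.
  apply: eq_fsbigr => y; rewrite inE => -[t _ <-].
  rewrite ge0_integralZl_EFin//; last by move=> x _; rewrite mule_ge0// lee_fin.
  by rewrite [X in _ = (_ * X)%E]integral_mkcond epatch_indic.
rewrite !intE//; congr (limn _); apply/funext => n.
by apply: eq_fsbigr => y _; rewrite hf.
Qed.

End condexp.

(** Convergence is recorded through the order alone, the form that survives composition with a
    monotone, possibly discontinuous function. *)
Lemma nnsfun_approx_lt (d : measure_display) (T : measurableType d)
  (R : realType) (f : T -> \bar R) :
  measurable_fun setT f -> (forall x, 0 <= f x)%E ->
  exists v : {nnsfun T >-> R}^nat,
  [/\ forall x, {homo (fun n => v n x) : m n / (m <= n)%N >-> m <= n},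
      forall n x, ((v n x)%:E <= f x)%E &
      forall x t, (t%:E < f x)%E -> exists n, t < v n x].
Proof.
move=> mf f0; exists (nnsfun_approx measurableT mf).
have nd x : {homo (fun n => nnsfun_approx measurableT mf n x) :
    m n / (m <= n)%N >-> m <= n}.
  by move=> m n mn; exact: (lefP _ _ (nd_nnsfun_approx measurableT mf mn)).
have fE x : f x =
    ereal_sup (range (fun n => (nnsfun_approx measurableT mf n x)%:E)).
  have fcvg := cvg_nnsfun_approx measurableT mf (fun x _ => f0 x) (I : setT x).
  rewrite -(cvg_lim _ fcvg)//.
  apply: (cvg_lim _ (ereal_nondecreasing_cvgn _)) => //.
  by move=> m n mn; rewrite lee_fin nd.
split=> // [n x|x t].
  by rewrite fE; apply: ereal_sup_ubound; exists n.
rewrite fE => /ereal_sup_gt[_ [n _ <-]]; rewrite lte_fin => tv.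
by exists n.
Qed.

(** * Musielak-Orlicz functions and measurable minorants *)

Section Musielak_Orlicz.
Context (R : realType) (d : measure_display) (T : measurableType d).
Variable phi : T -> R -> R.
Hypothesis mo : MO_function phi.

Let phi_ge0 x t : 0 <= t -> 0 <= phi x t.
Proof. by case: mo => + _ _ _ _; apply. Qed.

Let phi_le x s t : 0 <= s -> s <= t -> phi x s <= phi x t.
Proof. by case: mo => _ + _ _ _; apply. Qed.

Let phi_0 x : phi x 0 = 0.
Proof. by case: mo. Qed.

Lemma MO_unbounded x (z : \bar R) :
  (forall t, 0 <= t -> ((phi x t)%:E <= z)%E) -> z = +oo%E.
Proof.
have [_ _ _ /(_ x) phiy _] := mo => phiz; apply/eqyP => A A0.
have [t t0 At] : exists2 t, 0 <= t & A <= phi x t.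
  have /cvgryPge/(_ A) phiA := phiy.
  near (pinfty_nbhs R) => t; exists t; near: t => //.
  exact: nbhs_pinfty_ge.
by rewrite (le_trans _ (phiz t t0))// lee_fin.
Unshelve. all: by end_near. Qed.

(** [Phi] is a measurable substitute for [phi x (f x)]: the limit of [phi] along simple functions
    increasing to [f]. It dominates the values of [phi] strictly below [f x]. The last clause
    reduces a bound on its integral to functions [v] with bounded [phi x (v x)], whose integrals
    over a probability space are finite. *)
Lemma MO_minorant (mu : {measure set T -> \bar R}) (f : T -> \bar R) :
  measurable_fun setT f -> (forall x, 0 <= f x)%E ->
  exists Phi : T -> \bar R,
  [/\ measurable_fun setT Phi,
      forall x, (0 <= Phi x <= ext_at (fun x t => (phi x t)%:E) x (f x))%E,
      forall x t, 0 <= t -> (t%:E < f x)%E -> ((phi x t)%:E <= Phi x)%E &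
      forall z, (forall v : T -> R, measurable_fun setT v ->
          (forall x, 0 <= v x) -> (forall x, ((v x)%:E <= f x)%E) ->
          measurable_fun setT (fun x => phi x (v x)) ->
          (exists m, forall x, phi x (v x) <= m) ->
          (\int[mu]_x (phi x (v x))%:E <= z)%E) ->
        (\int[mu]_x Phi x <= z)%E].
Proof.
move=> mf f0; have [v [vnd vf fv]] := nnsfun_approx_lt _ _ _ _ mf f0.
have v0 n x : 0 <= v n x by exact: fun_ge0.
have mphiv n : measurable_fun setT (fun x => phi x (v n x)).
  by apply: measurable_fun_comp_nnsfun; case: mo.
have phind x : nondecreasing_seq (fun n => (phi x (v n x))%:E).
  by move=> m n mn; rewrite lee_fin phi_le// vnd.
have phicvg x := ereal_nondecreasing_cvgn (phind x).
pose Phi x := limn (fun n => (phi x (v n x))%:E).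
have Phi_ge n x : ((phi x (v n x))%:E <= Phi x)%E.
  by rewrite /Phi (cvg_lim _ (phicvg x))//; apply: ereal_sup_ubound; exists n.
exists Phi; split.
- apply: (emeasurable_fun_cvg (fun n x => (phi x (v n x))%:E)).
    by move=> n; apply/measurable_EFinP.
  by move=> x _; rewrite /Phi (cvg_lim _ (phicvg x)).
- move=> x; apply/andP; split.
    by apply: le_trans (Phi_ge 0 x); rewrite lee_fin phi_ge0.
  rewrite /Phi (cvg_lim _ (phicvg x))//; apply: ge_ereal_sup => _ [n _ <-].
  have := vf n x; case: (f x) (f0 x) => [r| |]//= _ => [|_]; last exact: leey.
  by rewrite !lee_fin; exact: phi_le.
- move=> x t t0 /fv[n tv]; apply: le_trans (Phi_ge n x).
  by rewrite lee_fin phi_le// ltW.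
move=> z hz; rewrite /Phi monotone_convergence//; last 2 first.
- by move=> n; apply/measurable_EFinP.
- by move=> n x _; rewrite lee_fin phi_ge0.
apply: lime_le.
  apply: ereal_nondecreasing_is_cvgn => m n mn; apply: le_integralT => x.
    by rewrite lee_fin phi_ge0.
  exact: phind.
apply: nearW => n.
(* Although [v n] is bounded, [phi x (v n x)] may be unbounded in [x]; so [v n] is cut to zero off
   [D m], and [m] then tends to infinity. *)
pose D m : set T := [set x | phi x (v n x) <= m%:R].
have mD m : measurable (D m).
  have := measurable_fun_le measurableT (mphiv n) (measurable_cst (m%:R : R)).
  by rewrite setTI.
pose w m x := v n x * \1_(D m) x.
have phiw m x : phi x (w m x) = phi x (v n x) * \1_(D m) x.
  by rewrite /w indicE; case: (_ \in _); rewrite ?mulr1// !mulr0 phi_0.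
have phiwnd x : nondecreasing_seq (fun m => (phi x (w m x))%:E).
  move=> m k mk; rewrite lee_fin !phiw ler_wpM2l ?phi_ge0//.
  rewrite !indicE; case: (boolP (x \in D m)) => //=; rewrite inE /D /= => xm.
  by rewrite mem_set//= (le_trans xm)// ler_nat.
have mphiw m : measurable_fun setT (fun x => phi x (w m x)).
  under eq_fun do rewrite phiw.
  by apply: measurable_funM => //; exact: measurable_indic.
have -> : (\int[mu]_x (phi x (v n x))%:E =
    \int[mu]_x limn (fun m => (phi x (w m x))%:E))%E.
  apply: eq_integral => x _; apply/esym/cvg_lim => //.
  apply: cvg_near_cst; near=> m.
  rewrite phiw indicE mem_set ?mulr1//=; near: m.
  exact: nbhs_infty_ger.
rewrite monotone_convergence//; last 2 first.
- by move=> m; apply/measurable_EFinP.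
- by move=> m x _; rewrite lee_fin phi_ge0// mulr_ge0.
apply: lime_le.
  apply: ereal_nondecreasing_is_cvgn => m k mk; apply: le_integralT => x.
    by rewrite lee_fin phi_ge0// mulr_ge0.
  exact: phiwnd.
apply: nearW => m; apply: hz => //.
- by apply: measurable_funM => //; exact: measurable_indic.
- by move=> x; rewrite mulr_ge0.
- by move=> x; apply: le_trans (vf n x); rewrite lee_fin ler_piMr// indicE.
- exists m%:R => x; rewrite phiw indicE.
  by case: (boolP (x \in D m)); rewrite ?mulr1 ?mulr0// inE.
Unshelve. all: by end_near. Qed.

(** For [s <= 1 <= p] one has [powR s p <= s]. Enlarging the constant covers [s = 1], and a constant
    of at least 2 later rules out [a <= a / C] for positive [a]. *)
Lemma lower_type_linear (p : R) : 1 <= p -> unif_lower_type phi p ->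
  exists2 C : R, 2 <= C &
    forall x t s, 0 <= t -> 0 < s <= 1 -> phi x (s * t) <= C * s * phi x t.
Proof.
move=> p1 [C0 hC0]; exists (Num.max C0 2); first by rewrite le_max lexx orbT.
have C2 : 2 <= Num.max C0 2 by rewrite le_max lexx orbT.
move=> x t s t0 /andP[s0]; rewrite le_eqVlt => /predU1P[->|s1].
  rewrite mulr1 mul1r ler_peMl ?phi_ge0//; lra.
apply: (le_trans (hC0 x t s t0 _)); first by rewrite s0.
have sps : powR s p <= s.
  by rewrite -[leRHS](powRr1 (ltW s0)); apply: ger_powR; rewrite // s0 ltW.
rewrite ler_wpM2r ?phi_ge0//.
apply: (@le_trans _ _ (Num.max C0 2 * powR s p)).
  by rewrite ler_wpM2r ?powR_ge0// le_max lexx.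
by rewrite ler_wpM2l//; lra.
Qed.

Lemma compl_fun_leP x t y :
  (compl_fun phi x t <= y%:E)%E <-> forall u, 0 < u -> u * t - phi x u <= y.
Proof.
split=> [le u u0|le].
  by rewrite -lee_fin (le_trans _ le)//; apply: ereal_sup_ubound; exists u.
by apply: ge_ereal_sup => _ [u u0 <-]; rewrite lee_fin le.
Qed.

Lemma compl_fun_mono x s t : s <= t ->
  (compl_fun phi x s <= compl_fun phi x t)%E.
Proof.
move=> st; apply: ge_ereal_sup => _ [u u0 <-].
apply: (@le_trans _ _ (u * t - phi x u)%:E).
  by rewrite lee_fin lerB// ler_wpM2l// ltW.
by apply: ereal_sup_ubound; exists u.
Qed.

(** * Complementary function and Young's inequality under linear lower type *)

Variable C : R.
Hypotheses (C2 : 2 <= C) (phiC : forall x t s, 0 <= t -> 0 < s <= 1 ->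
  phi x (s * t) <= C * s * phi x t).

(** The supremum runs over [u > 0], so [u = 0] is replaced by small [u]: linear lower type makes
    [phi x u] tend to 0 with [u]. *)
Lemma compl_fun_ge0 x t : 0 <= t -> (0 <= compl_fun phi x t)%E.
Proof.
move=> t0; apply/lee_addgt0Pr => e e0.
have C0 : 0 <= C by apply: le_trans C2.
have phi1 := phi_ge0 x 1 ler01.
(* This choice gives both [s <= 1] and [C * s * phi x 1 <= e]. *)
pose s := e / (e + C * phi x 1).
have D0 : 0 < e + C * phi x 1 by rewrite ltr_pwDl// mulr_ge0.
have s0 : 0 < s by rewrite divr_gt0.
have s1 : s <= 1 by rewrite ler_pdivrMr// mul1r lerDl mulr_ge0.
have phis : phi x s <= e.
  rewrite -[s]mulr1 (le_trans (phiC x 1 s ler01 _)) ?s0//.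
  have -> : C * s * phi x 1 = e * ((C * phi x 1) / (e + C * phi x 1)).
    by rewrite /s; ring.
  by apply: ler_piMr; rewrite ?(ltW e0)// ler_pdivrMr// mul1r lerDr ltW.
apply: (@le_trans _ _ ((s * t - phi x s)%:E + e%:E)%E); last first.
  by rewrite leeD2r//; apply: ereal_sup_ubound; exists s.
by rewrite -EFinD lee_fin; have := mulr_ge0 (ltW s0) t0; lra.
Qed.

(* The slope phi(w) / (C w) is an approximate subgradient of phi at w: the lower
   type gives phi(w) <= C (w / u) phi(u) for u >= w. *)
Lemma compl_fun_slope x w : 0 <= w ->
  (compl_fun phi x (phi x w / (C * w)) <= (phi x w / C)%:E)%E.
Proof.
move=> w0; apply/compl_fun_leP => u u0.
have C0 : 0 < C by apply: lt_le_trans C2.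
have [->|w_neq0] := eqVneq w 0.
  by rewrite phi_0 !mul0r mulr0 sub0r oppr_le0 phi_ge0// ltW.
have {w_neq0}w0 : 0 < w by rewrite lt_neqAle eq_sym w_neq0.
have phiwC : 0 <= phi x w / C by rewrite divr_ge0 ?phi_ge0 ?ltW.
have phiu := phi_ge0 x u (ltW u0).
have -> : u * (phi x w / (C * w)) = (u / w) * (phi x w / C).
  by rewrite invfM; ring.
(* For [u <= w] the linear term is at most [phi x w / C]; for [u > w], lower type with ratio [w / u]
   bounds it by [phi x u]. *)
have [uw|wu] := leP u w.
  rewrite lerBlDr (@le_trans _ _ (1 * (phi x w / C)))//.
    by apply: ler_wpM2r; rewrite ?ler_pdivrMr ?mul1r.
  by rewrite mul1r lerDl.
have := phiC x u (w / u) (ltW u0); rewrite divfK ?gt_eqF// divr_gt0//=.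
rewrite ler_pdivrMr// mul1r ltW// => /(_ isT) phiwu.
rewrite lerBlDr ler_wpDl//.
rewrite -ler_pdivlMl ?divr_gt0// invf_div ler_pdivrMr//.
by rewrite mulrAC [w / u * C]mulrC.
Qed.

(** Since the minorant controls [phi] only strictly below its argument, Young's inequality is
    available for [t < u] and must be passed to [u]. *)
Let mul_le_approx (c u z : R) : 0 <= c -> 0 <= u -> 0 <= z ->
  (forall t, 0 < t -> t < u -> t * c <= z) -> u * c <= z.
Proof.
move=> c0 u0 z0 tz; rewrite leNgt; apply/negP => zuc.
have {}c0 : 0 < c.
  by rewrite lt_neqAle c0 andbT; apply: contraTneq zuc => <-;
    rewrite mulr0 -leNgt.
have {}u0 : 0 < u.
  by rewrite lt_neqAle u0 andbT; apply: contraTneq zuc => <-;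
    rewrite mul0r -leNgt.
pose t := (u + z / c) / 2.
have zcu : z / c < u by rewrite ltr_pdivrMr.
have zc0 : 0 <= z / c by rewrite divr_ge0// ltW.
have tc : t * c = (u * c + z) / 2.
  by rewrite /t mulrAC mulrDl divfK ?gt_eqF.
have : t * c <= z by apply: tz; rewrite /t; lra.
by rewrite tc; lra.
Qed.

(** Bounding every [e k] by the supremum [M] gives a series of at most [M * G], with [G] the sum of
    the [a k]; Young's inequality is then applied to [G / lam] and [M / mu]. An infinite [M] or [G]
    makes the right side infinite. *)
Lemma young_series x (a : nat -> R) (e : nat -> \bar R) (lam mu : R)
  (Phi : \bar R) :
  0 < lam -> 0 < mu -> (forall k, 0 <= a k) -> (forall k, 0 <= e k)%E ->
  (0 <= Phi)%E ->
  (forall t, 0 <= t -> (t%:E < (\sum_(k <oo) (a k)%:E) / lam%:E)%E ->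
    ((phi x t)%:E <= Phi)%E) ->
  ((lam * mu)^-1%:E * \sum_(k <oo) ((a k)%:E * e k) <=
   Phi + ext_at (compl_fun phi) x
     (`|ereal_sup (range (fun k => `|e k|))| / mu%:E))%E.
Proof.
move=> lam0 mu0 a0 e0 Phi0.
set M := ereal_sup _; set G := (\sum_(k <oo) (a k)%:E)%E.
rewrite !inver !gt_eqF//= => Phit.
have eM k : (e k <= M)%E.
  by rewrite (le_trans (lee_abs _))//; apply: ereal_sup_ubound; exists k.
have M0 : (0 <= M)%E by exact: le_trans (e0 0) (eM 0).
have G0 : (0 <= G)%E by apply: nneseries_ge0 => k _ _; rewrite lee_fin.
rewrite gee0_abs//.
have Phi_neq : Phi != -oo%E by rewrite gt_eqF// (lt_le_trans _ Phi0).
move: M M0 eM => [r| |]// M0 eM; last first.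
  by rewrite gt0_mulye ?lte_fin ?invr_gt0//= addey// leey.
rewrite -EFinM /=; rewrite lee_fin in M0.
have rmu0 : 0 <= r / mu by rewrite divr_ge0// ltW.
have b0 := compl_fun_ge0 x _ rmu0.
have young t : 0 < t ->
    ((t * (r / mu))%:E <= (phi x t)%:E + compl_fun phi x (r / mu))%E.
  move=> t0; rewrite -leeBlDl// -EFinB.
  by apply: ereal_sup_ubound; exists t.
have sumM : (\sum_(k <oo) ((a k)%:E * e k) <= r%:E * G)%E.
  rewrite -nneseriesZl => [|k _]; last by rewrite lee_fin.
  apply: lee_nneseries => [k _ _|k _]; first by rewrite mule_ge0// lee_fin.
  by rewrite [leRHS]muleC; apply: lee_wpmul2l; rewrite ?lee_fin.
apply: (@le_trans _ _ ((lam * mu)^-1%:E * (r%:E * G))%E).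
  by apply: lee_wpmul2l => //; rewrite lee_fin invr_ge0 mulr_ge0 ?ltW.
move: G G0 Phit {sumM} => [y| |]// G0 Phit.
  rewrite -!EFinM in Phit *; rewrite lee_fin in G0.
  move: Phi Phi0 Phi_neq Phit b0 young => [f| |]// f0 _ Phit; last first.
    by move=> b0 _; rewrite addye ?leey// gt_eqF// (lt_le_trans _ b0).
  case: (compl_fun phi x (r / mu)) => [z| |]// z0 young; last by rewrite leey.
  rewrite !lee_fin in f0 z0 *.
  have -> : (lam * mu)^-1 * (r * y) = (y / lam) * (r / mu).
    by rewrite invfM; ring.
  apply: mul_le_approx => //; rewrite ?addr_ge0 ?divr_ge0// ?(ltW lam0)//.
  move=> t t0 ty.
  have := young t t0; rewrite lee_fin => /le_trans; apply.
  by rewrite lerD2r -lee_fin; apply: Phit; rewrite ?lte_fin ?ltW.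
suff -> : Phi = +oo%E by rewrite addye ?leey// gt_eqF// (lt_le_trans _ b0).
apply: (MO_unbounded x) => t t0.
by apply: Phit => //; rewrite gt0_mulye ?lte_fin ?invr_gt0// ltry.
Qed.

End Musielak_Orlicz.

Lemma lux_norm_ge0 (R : realType) (d : measure_display) (T : measurableType d)
  (P : probability T R) (psi : T -> R -> \bar R) (f : T -> \bar R) :
  (0 <= lux_norm P psi f)%E.
Proof. by apply: le_ereal_inf_tmp => _ [l [l0 _] <-]; rewrite lee_fin ltW. Qed.

(** * The duality estimate *)

Section dual_Doob.
Context (R : realType) (d : measure_display) (T : measurableType d).
Variables (P : probability T R) (F : nat -> set (set T)).
Variables (E : nat -> (T -> \bar R) -> T -> \bar R) (phi : T -> R -> R).
Hypotheses (filtF : filtration F)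
  (condE : forall n (f : T -> \bar R), measurable_fun setT f ->
     (forall x, (0 <= f x)%E) -> is_condexp P (F n) f (E n f)).
Hypothesis mo : MO_function phi.
Variables C K : R.
Hypotheses (C2 : 2 <= C) (phiC : forall x t s, 0 <= t -> 0 < s <= 1 ->
  phi x (s * t) <= C * s * phi x t).
Hypotheses (K1 : 1 <= K) (doobK : forall f : T -> R,
  measurable_fun setT f -> (forall x, 0 <= f x) ->
  (lux_norm P (compl_fun phi) (fun x => (f x)%:E) < +oo)%E ->
  (lux_norm P (compl_fun phi) (doob_max E (fun x => (f x)%:E))
     <= K%:E * lux_norm P (compl_fun phi) (fun x => (f x)%:E))%E).

Variable g : nat -> T -> R.
Hypotheses (mg : forall k, measurable_fun setT (g k))
  (g0 : forall k x, 0 <= g k x).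
Variable lam : R.
Hypotheses (lam0 : 0 < lam)
  (glam : (\int[P]_x ext_at (fun x t => (phi x t)%:E) x
             (`|\sum_(k <oo) (g k x)%:E| / lam%:E)%E <= 1)%E).

Local Notation sumg := (fun x => \sum_(k <oo) (g k x)%:E)%E.
Local Notation sumE := (fun x => \sum_(k <oo) E k (fun y => (g k y)%:E) x)%E.

Let C0 : 0 < C. Proof. exact: lt_le_trans C2. Qed.
Let K0 : 0 < K. Proof. exact: lt_le_trans K1. Qed.

Let phi_ge0 x t : 0 <= t -> 0 <= phi x t.
Proof. by case: mo => + _ _ _ _; apply. Qed.

Let phi_0 x : phi x 0 = 0.
Proof. by case: mo. Qed.

Let condexp_ge0 n (f : T -> R) x : measurable_fun setT f ->
  (forall x, 0 <= f x) -> (0 <= E n (fun y => (f y)%:E) x)%E.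
Proof.
move=> mf f0; have [||+ _ _] := condE n (fun y => (f y)%:E); last exact.
- exact/measurable_EFinP.
- by move=> y; rewrite lee_fin.
Qed.

Let measurable_condexp n (f : T -> R) : measurable_fun setT f ->
  (forall x, 0 <= f x) -> measurable_fun setT (E n (fun y => (f y)%:E)).
Proof.
move=> mf f0; have [||_ FE _] := condE n (fun y => (f y)%:E).
- exact/measurable_EFinP.
- by move=> y; rewrite lee_fin.
move=> _ B mB; by rewrite setTI; have [_ FT _] := filtF; exact/FT/FE.
Qed.

(** Both sides equal the integral of the product of the two conditional expectations. *)
Let condexp_sym n (f h : T -> R) :
  measurable_fun setT f -> measurable_fun setT h ->
  (forall x, 0 <= f x) -> (forall x, 0 <= h x) ->
  (\int[P]_x ((h x)%:E * E n (fun y => (f y)%:E) x) =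
   \int[P]_x ((f x)%:E * E n (fun y => (h y)%:E) x))%E.
Proof.
move=> mf mh f0 h0; have [sF FT _] := filtF.
have f0' y : (0 <= (f y)%:E)%E by rewrite lee_fin.
have h0' y : (0 <= (h y)%:E)%E by rewrite lee_fin.
have mf' : measurable_fun setT (fun y => (f y)%:E) by exact/measurable_EFinP.
have mh' : measurable_fun setT (fun y => (h y)%:E) by exact/measurable_EFinP.
have ef := condE n (fun y => (f y)%:E) mf' f0'.
have eh := condE n (fun y => (h y)%:E) mh' h0'.
have [Ef0 FEf _] := ef; have [Eh0 FEh _] := eh.
rewrite -(integralM_condexp _ _ _ _ _ (sF n) (FT n) _ _ _ mh' h0' eh Ef0 FEf).
rewrite -(integralM_condexp _ _ _ _ _ (sF n) (FT n) _ _ _ mf' f0' ef Eh0 FEh).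
by apply: eq_integral => x _; rewrite muleC.
Qed.

(** Symmetry moves each [E k] from [g k] onto [h], after which [young_series] applies pointwise.
    Admissibility of [lam] and of [mu] bounds each of the two resulting integrals by 1, whence the
    factor 2. *)
Lemma integral_condexp_series (h : T -> R) (mu : R) :
  measurable_fun setT h -> (forall x, 0 <= h x) -> 0 < mu ->
  (\int[P]_x ext_at (compl_fun phi) x
     (`|doob_max E (fun y => (h y)%:E) x| / mu%:E)%E <= 1)%E ->
  (\int[P]_x (sumE x * (h x)%:E) <= (2 * (lam * mu))%:E)%E.
Proof.
move=> mh h0 mu0 hmu.
have lm0 : 0 < lam * mu by rewrite mulr_gt0.
have G0 x : (0 <= sumg x)%E by apply: nneseries_ge0 => k _ _; rewrite lee_fin.
have mgE k : measurable_fun setT (fun x => (g k x)%:E).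
  exact/measurable_EFinP.
have mG : measurable_fun setT sumg.
  by apply: ge0_emeasurable_sum => // k x _ _; rewrite lee_fin.
have mX k : measurable_fun setT
    (fun x => (g k x)%:E * E k (fun y => (h y)%:E) x)%E.
  by apply: emeasurable_funM => //; exact: measurable_condexp.
have X0 k x : (0 <= (g k x)%:E * E k (fun y => (h y)%:E) x)%E.
  by rewrite mule_ge0 ?lee_fin// condexp_ge0.
have -> : (\int[P]_x (sumE x * (h x)%:E) =
    \int[P]_x \sum_(k <oo) ((g k x)%:E * E k (fun y => (h y)%:E) x))%E.
  rewrite integral_nneseries//.
  under eq_eseriesr => k _ do rewrite -condexp_sym//.
  rewrite -integral_nneseries//.
  - apply: eq_integral => x _; rewrite muleC -nneseriesZl// => k _.
    exact: condexp_ge0.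
  - move=> k; apply: emeasurable_funM; first exact/measurable_EFinP.
    exact: measurable_condexp.
  - by move=> k x _; rewrite mule_ge0 ?lee_fin// condexp_ge0.
have mGl : measurable_fun setT (fun x => sumg x * lam^-1%:E)%E.
  exact: emeasurable_funM.
have Gl0 x : (0 <= sumg x * lam^-1%:E)%E.
  by rewrite mule_ge0// lee_fin invr_ge0 ltW.
have [Phi [mPhi Phi_le Phi_ge _]] := MO_minorant _ _ _ phi mo P _ mGl Gl0.
have IPhi : (\int[P]_x Phi x <= 1)%E.
  apply: le_trans glam; apply: le_integralT => x.
    by have /andP[] := Phi_le x.
  rewrite gee0_abs// inver gt_eqF//.
  by have /andP[] := Phi_le x.
rewrite mulrC EFinM -lee_pdivrMl//.
have mXs : measurable_fun setT
    (fun x => \sum_(k <oo) ((g k x)%:E * E k (fun y => (h y)%:E) x))%E.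
  exact: ge0_emeasurable_sum.
rewrite -ge0_integralZl_EFin//; last 2 first.
- by move=> x _; exact: nneseries_ge0.
- by rewrite invr_ge0 ltW.
have le2 : (\int[P]_x Phi x + \int[P]_x ext_at (compl_fun phi) x
    (`|doob_max E (fun y => (h y)%:E) x| / mu%:E)%E <= 2%:E)%E.
  by rewrite (_ : 2 = 1 + 1)// EFinD leeD.
apply: le_trans le2; apply: le_integralT_add => //.
- exact: emeasurable_funM.
- move=> x; apply: mule_ge0; last exact: nneseries_ge0.
  by rewrite lee_fin invr_ge0 ltW.
- by move=> x; have /andP[] := Phi_le x.
- move=> x; rewrite inver gt_eqF//.
  case: (doob_max _ _ x) => [r| |] /=; rewrite ?leey//.
  + by apply: (compl_fun_ge0 _ _ _ _ mo _ C2 phiC);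
      rewrite mulr_ge0// invr_ge0 ltW.
  + by rewrite gt0_mulye ?lte_fin ?invr_gt0//= leey.
  + by rewrite gt0_mulye ?lte_fin ?invr_gt0//= leey.
- move=> x; apply: (young_series _ _ _ _ mo _ C2 phiC) => //.
  + by move=> k; exact: condexp_ge0.
  + by have /andP[] := Phi_le x.
  + by move=> t t0; rewrite inver gt_eqF//; exact: Phi_ge.
Qed.

(** Testing against [h], the approximate subgradient of [phi] at [v], gives
    [4 * K * lam * a <= 2 * lam * mu] with [a] the integral of [phi x (v x)] and [mu < 2 * K * b].
    Hence [a <= b], the maximum of [a / C] and 1, and [C >= 2] forces [a <= 1]. *)
Lemma integral_minorant_le1 (v : T -> R) :
  measurable_fun setT v -> (forall x, 0 <= v x) ->
  (forall x, ((v x)%:E <= sumE x * (4 * K * C * lam)^-1%:E)%E) ->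
  measurable_fun setT (fun x => phi x (v x)) ->
  (exists m, forall x, phi x (v x) <= m) ->
  (\int[P]_x (phi x (v x))%:E <= 1)%E.
Proof.
move=> mv v0 vS mphiv [m phim].
(* Where [v x = 0], the convention for division by zero gives [h x = 0]. *)
pose h x := phi x (v x) / (C * v x).
have h0 x : 0 <= h x by rewrite divr_ge0 ?phi_ge0// mulr_ge0// ltW.
have mh : measurable_fun setT h.
  rewrite (_ : h = fun x => phi x (v x) * (C * v x) `^ (-1)).
    apply: measurable_funM => //.
    have mCv : measurable_fun setT (fun x => C * v x) by exact: measurable_funM.
    exact: (measurableT_comp (measurable_powR (-1)) mCv).
  by apply/funext => x; rewrite powR_inv1// mulr_ge0// ltW.
have mphiE : measurable_fun setT (fun x => (phi x (v x))%:E).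
  exact/measurable_EFinP.
have phi0E x : (0 <= (phi x (v x))%:E)%E by rewrite lee_fin phi_ge0.
(* Finiteness, from the bound [m], is what later allows [a] to be absorbed. *)
have [a Ia] : exists a, (\int[P]_x (phi x (v x))%:E = a%:E)%E.
  exists (fine (\int[P]_x (phi x (v x))%:E)); rewrite fineK// ge0_fin_numE.
    apply: (@le_lt_trans _ _ (\int[P]_x m%:E)%E).
      by apply: le_integralT => // x; rewrite lee_fin.
    by rewrite integral_cst//= [X in (_ * X)%E]probability_setT mule1 ltry.
  exact: integral_ge0.
have a0 : 0 <= a by rewrite -lee_fin -Ia integral_ge0.
pose b := Num.max (a / C) 1.
have b1 : 1 <= b by rewrite le_max lexx orbT.
have b0 : 0 < b by exact: lt_le_trans b1.
have ab : a / C <= b by rewrite le_max lexx.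
have normh : (lux_norm P (compl_fun phi) (fun x => (h x)%:E) <= b%:E)%E.
  apply: ereal_inf_lbound; exists b => //; split=> //.
  have hb0 x : 0 <= h x / b by rewrite divr_ge0// ltW.
  apply: (@le_trans _ _ (\int[P]_x ((C * b)^-1%:E * (phi x (v x))%:E))%E).
    apply: le_integralT => x; rewrite inver gt_eqF//= ger0_norm//.
      exact: (compl_fun_ge0 _ _ _ _ mo _ C2 phiC).
    rewrite -EFinM; apply/compl_fun_leP => u u0.
    have /compl_fun_leP/(_ u u0) hu :=
      compl_fun_slope _ _ _ _ mo _ C2 phiC x _ (v0 x).
    rewrite -/(h x) in hu.
    (* As [b >= 1], this yields that the complementary function at [h x / b] is at most [1 / b]
       times its bound at [h x]. *)
    have phiu : phi x u / b <= phi x u.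
      by rewrite ler_pdivrMr// ler_peMr// phi_ge0// ltW.
    apply: (@le_trans _ _ ((u * h x - phi x u) / b)).
      by rewrite mulrBl mulrA lerB.
    rewrite [leRHS](_ : _ = phi x (v x) / C / b); last by rewrite invfM; ring.
    by rewrite ler_pM2r ?invr_gt0.
  rewrite ge0_integralZl_EFin//; last by rewrite invr_ge0 mulr_ge0 ?ltW.
  rewrite Ia lee_fin mulrC ler_pdivrMr ?mulr_gt0// mul1r.
  by rewrite mulrC -ler_pdivrMr.
(* The factor 2 makes the inequality strict, so an admissible [mu] below [2 * K * b] exists even if
   the infimum is not attained. *)
have normM : (lux_norm P (compl_fun phi)
    (doob_max E (fun x => (h x)%:E)) < (2 * K * b)%:E)%E.
  apply: le_lt_trans (doobK h mh h0 (le_lt_trans normh (ltry _))) _.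
  apply: (@le_lt_trans _ _ (K * b)%:E).
    by rewrite EFinM lee_wpmul2l// lee_fin ltW.
  by rewrite lte_fin ltr_pM2r// ltr_pMl// ltr1n.
have [_ [mu [mu0 hmu] <-]] := ereal_inf_lt normM.
rewrite lte_fin => mub.
have /(le_trans _) := integral_condexp_series h mu mh h0 mu0 hmu.
move=> /(_ (4 * K * lam * a)%:E).
(* The sum dominates [4 * K * C * lam * v], and [C * v * h = phi x (v x)]. *)
have SvC : ((4 * K * lam * a)%:E <= \int[P]_x (sumE x * (h x)%:E))%E.
  rewrite EFinM -Ia -ge0_integralZl_EFin//; last by rewrite !mulr_ge0 ?ltW.
  apply: le_integralT => x; first by rewrite mule_ge0// lee_fin !mulr_ge0 ?ltW.
  have [vx0|vx_neq0] := eqVneq (v x) 0.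
    rewrite vx0 phi_0 mule0; apply: mule_ge0; last by rewrite lee_fin.
    by apply: nneseries_ge0 => k _ _; exact: condexp_ge0.
  have := vS x; rewrite lee_pdivlMr ?mulr_gt0// => {}vS.
  apply: (@le_trans _ _ ((v x)%:E * (4 * K * C * lam)%:E * (h x)%:E)%E).
    rewrite -!EFinM lee_fin /h le_eqVlt; apply/orP; left; apply/eqP.
    by field; rewrite vx_neq0 gt_eqF.
  by apply: lee_wpmul2r; rewrite ?lee_fin.
move=> /(_ SvC); rewrite lee_fin => ha.
rewrite Ia lee_fin.
have : a <= b.
  rewrite -(ler_pM2l (mulr_gt0 (mulr_gt0 (ltr0n R 4) K0) lam0)).
  apply: (le_trans ha); rewrite [leLHS](_ : _ = 2 * lam * mu); last by ring.
  rewrite [leRHS](_ : _ = 2 * lam * (2 * K * b)); last by ring.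
  by rewrite ler_wpM2l ?mulr_ge0// ltW.
rewrite le_max => /orP[|//]; rewrite ler_pdivlMr// => aC.
have : a * 2 <= a by apply: le_trans aC; rewrite ler_wpM2l.
lra.
Qed.

(** Doubling the scale [c] puts the argument strictly below the sum over [c] wherever the sum is
    positive and finite, so [Phi] dominates [phi] there; this turns 4 into 8. *)
Lemma lux_norm_sum_condexp :
  (lux_norm P (fun x t => (phi x t)%:E) sumE <= (8 * K * C * lam)%:E)%E.
Proof.
pose c := 4 * K * C * lam; have c0 : 0 < c by rewrite !mulr_gt0.
have sumE0 x : (0 <= sumE x)%E.
  by apply: nneseries_ge0 => k _ _; exact: condexp_ge0.
have mS : measurable_fun setT (fun x => sumE x * c^-1%:E)%E.
  apply: emeasurable_funM => //; apply: ge0_emeasurable_sum => [k x _ _|k _].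
    exact: condexp_ge0.
  exact: measurable_condexp.
have S0 x : (0 <= sumE x * c^-1%:E)%E.
  by rewrite mule_ge0// lee_fin invr_ge0 ltW.
have [Phi [_ Phi_le Phi_ge IPhi]] := MO_minorant _ _ _ phi mo P _ mS S0.
have Phi0 x : (0 <= Phi x)%E by have /andP[] := Phi_le x.
apply: ereal_inf_lbound; exists (8 * K * C * lam) => //.
split; first by rewrite /= !mulr_gt0.
apply: (@le_trans _ _ (\int[P]_x Phi x)%E); last first.
  by apply: IPhi => v; exact: integral_minorant_le1.
have -> : 8 * K * C * lam = 2 * c by rewrite /c; ring.
have c20 : 0 < 2 * c by rewrite mulr_gt0.
apply: le_integralT => x; rewrite gee0_abs// inver gt_eqF//.
  case: (sumE x) (sumE0 x) => [r| |]//=.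
    by rewrite !lee_fin => r0; rewrite phi_ge0// divr_ge0// ltW.
  by rewrite gt0_mulye ?lte_fin ?invr_gt0.
(* Where the sum is infinite, [Phi] exceeds every [phi x t] and is infinite too. *)
move: (Phi_ge x); case: (sumE x) (sumE0 x) => [r| |]//=; last first.
  move=> _ Phix; rewrite gt0_mulye ?lte_fin ?invr_gt0//= leye_eq; apply/eqP.
  apply: (MO_unbounded _ _ _ _ mo x) => t t0; apply: Phix => //.
  by rewrite gt0_mulye ?lte_fin ?invr_gt0// ltry.
rewrite lee_fin le_eqVlt => /predU1P[<- _|r0].
  by rewrite mul0r phi_0.
apply; first by rewrite divr_ge0// ltW.
by rewrite lte_fin ltr_pM2l// ltf_pV2 ?posrE// ltr_pMl// ltr1n.
Qed.

End dual_Doob.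

Theorem theorem3p5 (R : realType) (d : measure_display) (T : measurableType d)
  (P : probability T R) (F : nat -> set (set T))
  (E : nat -> (T -> \bar R) -> T -> \bar R)
  (phi : T -> R -> R) (p : R) :
  filtration F ->
  (forall n (f : T -> \bar R), measurable_fun setT f -> (forall x, (0 <= f x)%E) ->
     is_condexp P (F n) f (E n f)) ->
  MO_function phi ->
  1 <= p -> unif_lower_type phi p ->
  (exists K : R, forall f : T -> R,
     measurable_fun setT f -> (forall x, 0 <= f x) ->
     (lux_norm P (compl_fun phi) (fun x => (f x)%:E) < +oo)%E ->
     (lux_norm P (compl_fun phi) (doob_max E (fun x => (f x)%:E))
        <= K%:E * lux_norm P (compl_fun phi) (fun x => (f x)%:E))%E) ->
  exists C : R, 0 < C /\
    forall g : nat -> T -> R,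
      (forall k, measurable_fun setT (g k)) -> (forall k x, 0 <= g k x) ->
      (lux_norm P (fun x t => (phi x t)%:E)
         (fun x => \sum_(k <oo) E k (fun y => (g k y)%:E) x)
       <= C%:E * lux_norm P (fun x t => (phi x t)%:E)
         (fun x => \sum_(k <oo) (g k x)%:E))%E.
Proof.
move=> filtF condE mo p1 low [K0 doobK0].
have [C C2 phiC] := lower_type_linear _ _ _ _ mo p p1 low.
(* The given bound may be nonpositive; a larger one remains valid because the norm is
   nonnegative. *)
pose K := Num.max K0 1.
have K1 : 1 <= K by rewrite le_max lexx orbT.
have doobK (f : T -> R) : measurable_fun setT f -> (forall x, 0 <= f x) ->
    (lux_norm P (compl_fun phi) (fun x => (f x)%:E) < +oo)%E ->
    (lux_norm P (compl_fun phi) (doob_max E (fun x => (f x)%:E))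
      <= K%:E * lux_norm P (compl_fun phi) (fun x => (f x)%:E))%E.
  move=> mf f0 ff; apply: (le_trans (doobK0 f mf f0 ff)).
  by apply: lee_wpmul2r; rewrite ?lux_norm_ge0// lee_fin le_max lexx.
have C8 : 0 < 8 * K * C.
  by rewrite !mulr_gt0//; [exact: lt_le_trans K1|exact: lt_le_trans C2].
exists (8 * K * C); split=> // g mg g0.
(* With the constant moved to the left, it suffices to bound by each admissible [lam] in the infimum
   defining the norm of the sum of the [g k]. *)
rewrite -lee_pdivrMl//; apply: le_ereal_inf_tmp => _ [lam [lam0 glam] <-].
rewrite lee_pdivrMl// -EFinM.
exact: (lux_norm_sum_condexp _ _ _ P F E phi filtF condE mo C K C2 phiC K1 doobK
  g mg g0 lam lam0 glam).
Qed.
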